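(* Let $f:\{0,1\}^n\to\{0,1\}$ be a symmetric Boolean function. Then $Q_E(f)=n$ if and only if $f$ is isomorphic to $\mathrm{AND}_n$.
   Context: $f$ is symmetric if $f(x)$ depends only on the Hamming weight $|x|$ (number of ones) of $x$. $\mathrm{AND}_n(x)=1$ iff all $n$ input bits are $1$. Two Boolean functions are isomorphic if one can be obtained from the other by permuting the input variables, negating some input variables, and possibly negating the output. $Q_E(f)$ is the exact quantum query complexity: the minimum number $t$ of queries in a quantum algorithm of the form $U_{t+1}QU_t\cdots QU_1$ applied to a fixed initial state in a Hilbert space with fixed orthonormal basis (the $U_j$ input-independent unitaries; $Q$ multiplies each basis state associated with index $i\in[n]$ by $(-1)^{x_i}$ and fixes basis states associated with no index), followed by a measurement in that basis, whose output equals $f(x)$ with probability $1$ for every input $x$. *)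

(* Defs.v *)
From HB Require Import structures.
From mathcomp Require Import all_boot all_order all_fingroup all_algebra.
From mathcomp Require Import reals complex.

Set Implicit Arguments.
Unset Strict Implicit.
Unset Printing Implicit Defensive.

Import Order.TTheory GRing.Theory Num.Theory.
Local Open Scope ring_scope.
Local Open Scope complex_scope.

Notation input n := {ffun 'I_n -> bool}.
Notation boolfun n := (input n -> bool).

Definition weight (n : nat) (x : input n) : nat := #|[set i | x i]|.

Definition symmetric_fun (n : nat) (f : boolfun n) : Prop :=
  forall x y : input n, weight x = weight y -> f x = f y.

Definition AND (n : nat) : boolfun n := fun x => [forall i, x i].

Definition isomorphic (n : nat) (f g : boolfun n) : Prop :=
  exists (s : 'S_n) (b : input n) (c : bool),
    forall x : input n, f x = c (+) g [ffun i => b i (+) x (s i)].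

(* The Hilbert space is C^qdim with its standard basis.  [qlabel k] is the
   index queried by the k-th basis state, [None] if there is none.  Numbering
   is from 0: [qunitary j] is the unitary applied after j queries, so only
   [qunitary 0], ..., [qunitary t] occur in an algorithm making t queries. *)
Record qalgorithm (R : realType) (n t : nat) := QAlgorithm {
  qdim : nat;
  qlabel : 'I_qdim -> option 'I_n;
  qinit : 'cV[R[i]]_qdim;
  qunitary : nat -> 'M[R[i]]_qdim;
  qoutput : 'I_qdim -> bool;
  _ : \sum_k `|qinit k 0| ^+ 2 = 1;
  _ : forall j, (j <= t)%N -> qunitary j \is unitarymx
}.

Definition query_mx (R : realType) (n t : nat) (A : qalgorithm R n t)
    (x : input n) : 'M[R[i]]_(qdim A) :=
  diag_mx (\row_k if qlabel k is Some i then (-1) ^+ x i else 1).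

Fixpoint qstate (R : realType) (n t : nat) (A : qalgorithm R n t)
    (x : input n) (j : nat) : 'cV[R[i]]_(qdim A) :=
  if j is j'.+1 then qunitary A j *m (query_mx A x *m qstate A x j')
  else qunitary A 0 *m qinit A.

Definition output_prob (R : realType) (n t : nat) (A : qalgorithm R n t)
    (x : input n) (b : bool) : R[i] :=
  \sum_(k | qoutput k == b) `|qstate A x t k 0| ^+ 2.

Definition computes_exactly (R : realType) (n t : nat) (A : qalgorithm R n t)
    (f : boolfun n) : Prop :=
  forall x : input n, output_prob A x (f x) = 1.

(* Q_E(f) = t *)
Definition exact_query_complexity_is (R : realType) (n : nat) (f : boolfun n)
    (t : nat) : Prop :=
  (exists A : qalgorithm R n t, computes_exactly A f) /\
  (forall (t' : nat) (A : qalgorithm R n t'), computes_exactly A f ->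
     (t <= t')%N).

(* Main.v *)
(* Upper bounds.  An exact algorithm exists as soon as the Gram matrices of its
   states over the inputs can be prescribed: start from the all-ones matrix,
   let each query multiply the component at index [i] by the signs of [x_i],
   and end with a matrix vanishing at pairs with [f x != f y]; real families
   with equal Gram matrices are related by products of Householder
   reflections.  Gram matrices add up, so writing one as a sum of rank-one terms
   plays the role of an intermediate measurement.  For a uniform query over N
   signs, with S the sum of the signs, two identities give such sums:
     N sum_k x_k y_k = S(x) S(y) + sum_{i<j} (x_i - x_j)(y_i - y_j)
   decides in m queries whether 2m bits are balanced, and
     (N-1)^2 sum_k x_k y_k = sum_i (S(x) - x_i)(S(y) - y_i)
                             + (N-2) sum_{i<j} (x_i - x_j)(y_i - y_j)
   gives the majority of 2m-1 bits in m queries.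
   Now let a symmetric f be not isomorphic to AND_n.  Either both restrictions of
   a bit are again of this kind, and one queries it, or f is, up to negations, one
   of: "all bits equal" (n-1 XOR queries), "weight n-1" (balancedness after padding
   with n-2 zeros), "weight at least n-1" (majority after padding with n-3 zeros).

   Lower bound.  After t queries the amplitudes are polynomials of degree at most t
   in the input, whereas for f isomorphic to AND_n some amplitude is nonzero at
   exactly one point of the cube, hence has degree n. *)
Require Import Defs.
From mathcomp Require Import all_boot all_order all_fingroup all_algebra.
From mathcomp Require Import reals complex boolp zify ring lra.

Set Implicit Arguments.
Unset Strict Implicit.
Unset Printing Implicit Defensive.

Import Order.TTheory GRing.Theory Num.Theory.
Local Open Scope ring_scope.

(** * Calculus of Gram matrices of states *)

Section Gram.
Variables (R : realType) (n : nat).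

Definition bit_sign (l : option 'I_n) (x : input n) : R :=
  if l is Some i then (-1) ^+ x i else 1.

(** A pair [(l, v)] is a basis state with query label [l] and real amplitude [v x] on input [x].
    Lists leave the dimension free to change from one query to the next. *)
Definition amplitudes := seq (option 'I_n * (input n -> R)).

Definition gram (s : amplitudes) (x y : input n) : R :=
  \sum_(p <- s) p.2 x * p.2 y.

Definition query_gram (s : amplitudes) (x y : input n) : R :=
  \sum_(p <- s) bit_sign p.1 x * bit_sign p.1 y * (p.2 x * p.2 y).

Variable f : boolfun n.

(** The unitaries between queries stay implicit: before each query any [s] realising [G] may be
    chosen. One is also required when no query remains, since the final states must exist as
    vectors. *)
Fixpoint solvable (t : nat) (G : input n -> input n -> R) : Prop :=
  exists2 s, (forall x y, G x y = gram s x y) &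
    if t is t'.+1 then solvable t' (query_gram s)
    else forall x y, f x != f y -> G x y = 0.

Lemma bit_signM l x : bit_sign l x * bit_sign l x = 1.
Proof. by case: l => [i|] /=; rewrite ?mulr1 // -expr2 sqrr_sign. Qed.

Lemma eq_solvable t G H :
  (forall x y, G x y = H x y) -> solvable t G -> solvable t H.
Proof.
case: t => [|t] eqGH /= [s Gs solv]; exists s => // x y; rewrite -eqGH //.
exact: solv.
Qed.

(** Direct sum: both branches run side by side on orthogonal subspaces. *)
Lemma solvableD t G H : solvable t G -> solvable t H ->
  solvable t (fun x y => G x y + H x y).
Proof.
elim: t G H => [|t IHt] G H /= [s Gs solG] [r Hr solH]; exists (s ++ r).
- by move=> x y; rewrite /gram big_cat Gs Hr.
- by move=> x y fxy; rewrite solG ?solH ?addr0.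
- by move=> x y; rewrite /gram big_cat Gs Hr.
- apply: eq_solvable (IHt _ _ solG solH) => x y.
  by rewrite /query_gram big_cat.
Qed.

Lemma solvable0 t : solvable t (fun _ _ => 0).
Proof.
have gram0 x y : 0 = gram [::] x y by rewrite /gram big_nil.
elim: t => [|t IHt] /=; exists [::] => //.
by apply: eq_solvable IHt => x y; rewrite /query_gram big_nil.
Qed.

Lemma solvable_sum t (I : Type) (r : seq I) (P : pred I)
    (G : I -> input n -> input n -> R) :
  (forall i, P i -> solvable t (G i)) ->
  solvable t (fun x y => \sum_(i <- r | P i) G i x y).
Proof.
move=> solG; elim: r => [|i r IHr].
  by apply: eq_solvable (solvable0 t) => x y; rewrite big_nil.
case: (boolP (P i)) => Pi.
  apply: eq_solvable (solvableD (solG i Pi) IHr) => x y.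
  by rewrite big_cons Pi.
by apply: eq_solvable IHr => x y; rewrite big_cons (negbTE Pi).
Qed.

(** A factor depending only on the input passes through every query. It serves as the amplitude with
    which a branch is entered. *)
Lemma solvableM t G (v : input n -> R) : solvable t G ->
  solvable t (fun x y => v x * v y * G x y).
Proof.
pose scale (s : amplitudes) : amplitudes := [seq (p.1, fun x => v x * p.2 x) | p <- s].
have gramM s x y : v x * v y * gram s x y = gram (scale s) x y.
  by rewrite /gram big_map mulr_sumr; apply: eq_bigr => p _ /=; ring.
elim: t G => [|t IHt] G /= [s Gs solG]; exists (scale s).
- by move=> x y; rewrite Gs gramM.
- by move=> x y fxy; rewrite solG ?mulr0.
- by move=> x y; rewrite Gs gramM.
- apply: eq_solvable (IHt _ solG) => x y.
  by rewrite /query_gram big_map mulr_sumr; apply: eq_bigr => p _ /=; ring.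
Qed.

(* Solving [f] on the inputs in [D] from a single basis state: the Gram matrix
   is the all-ones matrix restricted to [D]. *)
Definition solvable_on (t : nat) (D : pred (input n)) : Prop :=
  solvable t (fun x y => (D x)%:R * (D y)%:R).

Lemma eq_solvable_on t (D D' : pred (input n)) :
  D =1 D' -> solvable_on t D -> solvable_on t D'.
Proof. by move=> eqD; apply: eq_solvable => x y; rewrite !eqD. Qed.

(** The answer is already known on [D], so the remaining queries are spent on a state with label
    [None], where they do nothing. *)
Lemma solvable_on_const t (D : pred (input n)) b :
  (forall x, D x -> f x = b) -> solvable_on t D.
Proof.
move=> fD; pose s : amplitudes := [:: (None, fun x => (D x)%:R)].
elim: t => [|t IHt] /=; exists s.
- by move=> x y; rewrite /gram big_seq1.
- move=> x y fxy; case: (boolP (D x)) => [Dx|_]; last by rewrite mul0r.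
  case: (boolP (D y)) => [Dy|_]; last by rewrite mulr0.
  by rewrite (fD x) // (fD y) // eqxx in fxy.
- by move=> x y; rewrite /gram big_seq1.
- by apply: eq_solvable IHt => x y; rewrite /query_gram big_seq1 /= !mul1r.
Qed.

(** * Queries in uniform superposition *)

Section Slots.
(* A slot is a query position carrying the bit of a variable, negated or not,
   or a constant padding bit. *)
Variables (K : finType) (lab : K -> option 'I_n) (neg : pred K).

Definition slot_bit (k : K) (x : input n) : bool :=
  neg k (+) (if lab k is Some i then x i else false).

Definition slot_sign (k : K) (x : input n) : R := (-1) ^+ slot_bit k x.

Definition slot_count (A : {set K}) (x : input n) : nat :=
  (\sum_(k in A) slot_bit k x)%N.

Lemma slot_signE k x : slot_sign k x = (-1) ^+ neg k * bit_sign (lab k) x.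
Proof.
by rewrite /slot_sign /slot_bit signr_addb; case: (lab k) => [i|] //=.
Qed.

Lemma slot_signN k x : slot_sign k x = 1 - (slot_bit k x)%:R *+ 2.
Proof. by rewrite /slot_sign; case: slot_bit => /=; ring. Qed.

Lemma sum_slot_sign (A : {set K}) x :
  \sum_(k in A) slot_sign k x = #|A|%:R - (slot_count A x)%:R *+ 2.
Proof.
rewrite (eq_bigr _ (fun k _ => slot_signN k x)) sumrB sumr_const sumrMnl.
by rewrite /slot_count natr_sum.
Qed.

Lemma sum_slot_sign_eq0 (A : {set K}) x :
  (\sum_(k in A) slot_sign k x == 0) = (2 * slot_count A x == #|A|)%N.
Proof. by rewrite sum_slot_sign -mulrnA mulnC subr_eq0 eqr_nat eq_sym. Qed.

Lemma subr_slot_sign_eq0 i j x :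
  (slot_sign i x - slot_sign j x == 0) = (slot_bit i x == slot_bit j x).
Proof. by rewrite subr_eq0 (inj_eq (@signr_inj R)). Qed.

(* After one query in uniform superposition over [A], any expression of the
   Gram matrix as a positive combination of rank-one terms [v j] may be
   measured: outcome [j] tells that [v j x] is nonzero. *)
Lemma solvable_on_query t (A : {set K}) (D : pred (input n)) (J : finType) (P : pred J)
    (c : J -> R) (v : J -> input n -> R) :
  (0 < #|A|)%N -> (forall j, P j -> 0 <= c j) ->
  (forall x y, \sum_(k in A) slot_sign k x * slot_sign k y =
     \sum_(j | P j) c j * (v j x * v j y)) ->
  (forall j, P j -> solvable_on t [pred x | D x && (v j x != 0)]) ->
  solvable_on t.+1 D.
Proof.
move=> A_gt0 c_ge0 decomp solD; pose a := Num.sqrt (#|A|%:R^-1 : R).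
have aa : a * a = #|A|%:R^-1 by rewrite -expr2 sqr_sqrtr ?invr_ge0 ?ler0n.
(* Each amplitude carries the sign of [neg k] in advance, so that querying [lab k] produces
   [slot_sign k x]. In the Gram matrix before the query these signs square to one. *)
exists [seq (lab k, fun x => a * (D x)%:R * (-1) ^+ neg k) | k <- enum A].
  move=> x y; rewrite /gram big_map big_enum /=.
  rewrite (eq_bigr (fun=> a * a * ((D x)%:R * (D y)%:R))); last first.
    move=> k _ /=; have := sqrr_sign R (neg k).
    by move: (_ ^+ neg k) => e ee; rewrite -[RHS]mulr1 -ee; ring.
  rewrite sumr_const aa -[RHS]mulr_natl mulrA divff ?mul1r //.
  by rewrite pnatr_eq0 -lt0n.
have sol j : P j -> solvable t (fun x y =>
    (a * Num.sqrt (c j) * v j x) * (a * Num.sqrt (c j) * v j y) *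
    ((D x && (v j x != 0))%:R * (D y && (v j y != 0))%:R)).
  by move=> Pj; apply: (@solvableM _ _ (fun x => a * Num.sqrt (c j) * v j x)); exact: solD.
apply: eq_solvable (solvable_sum (index_enum J) sol) => x y.
rewrite /query_gram big_map big_enum /=.
transitivity (a * a * ((D x)%:R * (D y)%:R) * (\sum_(k in A) slot_sign k x * slot_sign k y)).
  rewrite decomp mulr_sumr; apply: eq_bigr => j Pj.
  have /sqr_sqrtr cc := c_ge0 j Pj; rewrite -[c j in RHS]cc.
  (* Restricting [D] to the support of [v j] loses nothing, as the term vanishes elsewhere. *)
  case: (eqVneq (v j x) 0) => [->|_]; first by rewrite andbF; ring.
  case: (eqVneq (v j y) 0) => [->|_]; first by rewrite andbF; ring.
  by rewrite !andbT; ring.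
rewrite mulr_sumr; apply: eq_bigr => k _; rewrite !slot_signE.
by move: (_ ^+ neg k) => e /=; ring.
Qed.

(** Polarised Lagrange identity. Ordered pairs are summed, so each unordered pair counts twice and
    the diagonal contributes zero. *)
Lemma sum_pair_diff (A : {set K}) (u w : K -> R) :
  \sum_(p : K * K | (p.1 \in A) && (p.2 \in A))
     (u p.1 - u p.2) * (w p.1 - w p.2) =
  #|A|%:R *+ 2 * (\sum_(k in A) u k * w k) -
  (\sum_(k in A) u k) * (\sum_(k in A) w k) *+ 2.
Proof.
rewrite -(pair_big (mem A) (mem A) (fun i j => (u i - u j) * (w i - w j))) /=.
set P := \sum_(k in A) u k * w k; set S := \sum_(k in A) u k.
set T := \sum_(k in A) w k.
rewrite (eq_bigr (fun i => #|A|%:R * (u i * w i) - u i * T - w i * S + P)).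
  rewrite big_split !sumrB /= -!mulr_sumr -!mulr_suml -/P -/S -/T sumr_const.
  by rewrite -[P *+ _]mulr_natl; ring.
move=> i _; rewrite (eq_bigr (fun j =>
  u i * w i - u i * w j - w i * u j + u j * w j)); last by move=> j _; ring.
rewrite big_split !sumrB /= sumr_const -!mulr_sumr -/P -/S -/T.
by rewrite -[_ *+ #|A|]mulr_natl.
Qed.

(** The first uniform-query identity, read as a measurement: outcome [inl tt] certifies that the
    slots are not balanced, outcome [inr (i, j)] that slots [i] and [j] differ. *)
Lemma solvable_on_balance t (A : {set K}) (D : pred (input n)) :
  (0 < #|A|)%N ->
  solvable_on t [pred x | D x && ((2 * slot_count A x)%N != #|A|)] ->
  (forall i j, i \in A -> j \in A -> i != j ->
     solvable_on t [pred x | D x && (slot_bit i x != slot_bit j x)]) ->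
  solvable_on t.+1 D.
Proof.
move=> A_gt0 sol_count sol_diff; have NA0 : #|A|%:R != 0 :> R by rewrite pnatr_eq0 -lt0n.
apply: (@solvable_on_query t A D (unit + K * K)%type
  (fun q => if q is inr p then (p.1 \in A) && (p.2 \in A) else true)
  (fun q => if q is inr _ then (#|A|%:R *+ 2)^-1 else #|A|%:R^-1)
  (fun q x => if q is inr p then slot_sign p.1 x - slot_sign p.2 x
              else \sum_(k in A) slot_sign k x)) => //.
- by case=> [_|_] _; rewrite invr_ge0 -?mulrnA ler0n.
- move=> x y; rewrite big_sumType big_const card_unit /= addr0 -mulr_sumr.
  rewrite (sum_pair_diff A (slot_sign^~ x) (slot_sign^~ y)) /=.
  by field.
- case=> [_ _|[i j] /= /andP[iA jA]].
    by apply: eq_solvable_on sol_count => x /=; rewrite sum_slot_sign_eq0.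
  case: (eqVneq i j) => [<-|ij].
    by apply: (@solvable_on_const _ _ true) => x /=; rewrite subrr eqxx andbF.
  by apply: eq_solvable_on (sol_diff i j iA jA ij) => x /=; rewrite subr_slot_sign_eq0.
Qed.

(** The second identity: outcome [inl i] certifies that the slots other than [i] are not balanced,
    since S - x_i is the sum of their signs. *)
Lemma solvable_on_majority_query t (A : {set K}) (D : pred (input n)) :
  (1 < #|A|)%N ->
  (forall i, i \in A -> solvable_on t
     [pred x | D x && ((2 * slot_count (A :\ i) x)%N != #|A|.-1)]) ->
  (forall i j, i \in A -> j \in A -> i != j ->
     solvable_on t [pred x | D x && (slot_bit i x != slot_bit j x)]) ->
  solvable_on t.+1 D.
Proof.
move=> A_gt1 sol_count sol_diff.
(* The coefficients [#|A|] - 1 and [#|A|] - 2 of the identity become [N.+1] and [N]. *)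
have [N def_N] : exists N, #|A| = N.+2 by exists #|A|.-2; lia.
have NA0 : (N.+1)%:R != 0 :> R by rewrite pnatr_eq0.
apply: (@solvable_on_query t A D (K + K * K)%type
  (fun q => match q with inr p => (p.1 \in A) && (p.2 \in A) | inl k => k \in A end)
  (fun q => if q is inr _ then N%:R / (N.+1%:R ^+ 2 *+ 2) else (N.+1%:R ^+ 2)^-1)
  (fun q x => match q with inr p => slot_sign p.1 x - slot_sign p.2 x
              | inl i => \sum_(k in A :\ i) slot_sign k x end)) => //.
- by rewrite def_N.
- by case=> [_|_] _; rewrite ?divr_ge0 ?invr_ge0 ?ler0n ?mulrn_wge0 ?exprn_ge0 ?ler0n.
- move=> x y; rewrite big_sumType /= -!mulr_sumr.
  rewrite (sum_pair_diff A (slot_sign^~ x) (slot_sign^~ y)) /=.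
  have sum1 z i : i \in A -> \sum_(k in A :\ i) slot_sign k z =
      \sum_(k in A) slot_sign k z - slot_sign i z.
    move=> iA; rewrite (bigD1 i iA) /= addrAC subrr add0r.
    by apply: eq_bigl => k; rewrite !inE andbC.
  set P := \sum_(k in A) slot_sign k x * slot_sign k y.
  set S := \sum_(k in A) slot_sign k x; set T := \sum_(k in A) slot_sign k y.
  rewrite [\sum_(i in A) _ in RHS](eq_bigr (fun i => S * T - slot_sign i x * T
    - slot_sign i y * S + slot_sign i x * slot_sign i y)); last first.
    by move=> i iA; rewrite !sum1 // -/S -/T; ring.
  rewrite big_split !sumrB /= sumr_const -!mulr_suml -/P -/S -/T.
  rewrite -[_ *+ #|A|]mulr_natl def_N.
  have -> : N.+2%:R = N.+1%:R + 1 :> R by rewrite -natr1.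
  have -> : N%:R = N.+1%:R - 1 :> R by rewrite -natr1; ring.
  move: (N.+1%:R) NA0 => M NA0.
  by field.
- case=> [i iA|[i j] /= /andP[iA jA]].
    apply: eq_solvable_on (sol_count i iA) => x /=; rewrite sum_slot_sign_eq0.
    by rewrite [#|A|](cardsD1 i) iA.
  case: (eqVneq i j) => [<-|ij].
    by apply: (@solvable_on_const _ _ true) => x /=; rewrite subrr eqxx andbF.
  by apply: eq_solvable_on (sol_diff i j iA jA ij) => x /=; rewrite subr_slot_sign_eq0.
Qed.

End Slots.

(** * Single-bit, XOR, exact-half and majority queries *)

Lemma slot_count0 (K : finType) (lab : K -> option 'I_n) neg x :
  slot_count lab neg set0 x = 0%N.
Proof. by rewrite /slot_count big_set0. Qed.

Lemma slot_countD1 (K : finType) (lab : K -> option 'I_n) neg (A : {set K}) i x :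
  i \in A ->
  slot_count lab neg A x = (slot_bit lab neg i x + slot_count lab neg (A :\ i) x)%N.
Proof.
move=> iA; rewrite /slot_count (bigD1 i iA) /=; congr (_ + _)%N.
by apply: eq_bigl => k; rewrite !inE andbC.
Qed.

(** A balance query on [x i] and the constant zero slot [None]: the two are balanced exactly when
    [x i] is one. *)
Lemma solvable_on_classical t (D : pred (input n)) i :
  (forall b, solvable_on t [pred x | D x && (x i == b)]) -> solvable_on t.+1 D.
Proof.
move=> sol; have count2 x :
    slot_count id xpred0 [set None; Some i] x = x i.
  rewrite (@slot_countD1 _ _ _ _ None) ?set21 // /slot_count (big_pred1 (Some i)).
    by rewrite /slot_bit /= add0n.
  by move=> k; rewrite !inE; case: k.
have card2 : #|[set None; Some i]| = 2%N by rewrite cards2.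
apply: (@solvable_on_balance _ id xpred0 t [set None; Some i]).
- by rewrite card2.
- apply: eq_solvable_on (sol false) => x /=; rewrite count2 card2.
  by case: (x i).
- move=> j k; rewrite !inE => /orP[]/eqP-> /orP[]/eqP->; rewrite ?eqxx // => _;
    apply: eq_solvable_on (sol true) => x /=; rewrite /slot_bit /=;
    by case: (x i).
Qed.

Lemma solvable_on_xor t (D : pred (input n)) i j : i != j ->
  (forall b, solvable_on t [pred x | D x && ((x i == x j) == b)]) ->
  solvable_on t.+1 D.
Proof.
move=> ij sol; have count2 x :
    slot_count (@Some 'I_n) xpred0 [set i; j] x = (x i + x j)%N.
  by rewrite /slot_count big_setU1 ?inE // big_set1.
have card2 : #|[set i; j]| = 2%N by rewrite cards2 ij.
apply: (@solvable_on_balance _ (@Some 'I_n) xpred0 t [set i; j]).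
- by rewrite card2.
- apply: eq_solvable_on (sol true) => x /=; rewrite count2 card2.
  by case: (x i); case: (x j).
- move=> k l; rewrite !inE => /orP[]/eqP-> /orP[]/eqP->; rewrite ?eqxx // => _;
    apply: eq_solvable_on (sol false) => x /=; rewrite /slot_bit /=;
    by case: (x i); case: (x j).
Qed.

(** An unbalanced outcome settles the answer. A differing pair holds one one and one zero, so
    dropping it preserves the question with [m] lowered by one. *)
Lemma solvable_on_exact_half (K : finType) (lab : K -> option 'I_n) neg m
    (A : {set K}) (D : pred (input n)) e :
  #|A| = (2 * m)%N ->
  (forall x, D x -> f x = e (+) (slot_count lab neg A x == m)) ->
  solvable_on m D.
Proof.
elim: m A D => [|m IHm] A D cardA fD.
  move/eqP: cardA; rewrite muln0 cards_eq0 => /eqP A0.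
  by apply: (@solvable_on_const _ _ (e (+) true)) => x /fD; rewrite A0 slot_count0.
apply: (@solvable_on_balance _ lab neg m A); first by rewrite cardA.
  apply: (@solvable_on_const _ _ e) => x /= /andP[/fD->].
  by rewrite cardA eqn_mul2l /= => /negbTE->; rewrite addbF.
move=> i j iA jA ij; have jAi : j \in A :\ i by rewrite !inE eq_sym ij.
apply: (IHm (A :\ i :\ j)).
  by move: cardA; rewrite (cardsD1 i) iA (cardsD1 j) jAi; lia.
move=> x /= /andP[/fD-> bij].
rewrite (slot_countD1 _ _ _ iA) (slot_countD1 _ _ _ jAi).
by move: bij; case: slot_bit; case: slot_bit.
Qed.

(** If the evenly many slots other than [i] are not balanced, their lead is at least two, so neither
    slot [i] nor one further slot [j] affects the majority and both are dropped. A differing pair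
    cancels. *)
Lemma solvable_on_majority (K : finType) (lab : K -> option 'I_n) neg m
    (A : {set K}) (D : pred (input n)) e :
  #|A| = (2 * m).+1 ->
  (forall x, D x -> f x = e (+) (m < slot_count lab neg A x)%N) ->
  solvable_on m.+1 D.
Proof.
elim: m A D => [|m IHm] A D cardA fD.
  move/eqP: cardA => /cards1P[k A1].
  have count1 x : slot_count lab neg A x = slot_bit lab neg k x.
    by rewrite A1 /slot_count big_set1.
  case labk: (lab k) => [i|].
    apply: (@solvable_on_classical _ _ i) => b.
    apply: (@solvable_on_const _ _ (e (+) (neg k (+) b))) => x /= /andP[/fD->].
    by rewrite count1 /slot_bit labk => /eqP->; case: (neg k); case: b.
  apply: (@solvable_on_const _ _ (e (+) neg k)) => x /= /fD->.
  by rewrite count1 /slot_bit labk; case: (neg k).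
apply: (@solvable_on_majority_query _ lab neg m.+1 A); first by rewrite cardA.
  move=> i iA; have cardAi : #|A :\ i| = (2 * m.+1)%N.
    by move: cardA; rewrite (cardsD1 i) iA; lia.
  have [j jAi] : exists j, j \in A :\ i by apply/card_gt0P; rewrite cardAi.
  apply: (IHm (A :\ i :\ j)).
    by move: cardAi; rewrite (cardsD1 j) jAi; lia.
  move=> x /= /andP[/fD->]; rewrite cardA.
  rewrite (slot_countD1 _ _ _ iA) (slot_countD1 _ _ _ jAi) => ne.
  congr (_ (+) _); move: ne; case: slot_bit; case: slot_bit => /=; lia.
move=> i j iA jA ij; have jAi : j \in A :\ i by rewrite !inE eq_sym ij.
apply: (IHm (A :\ i :\ j)).
  by move: cardA; rewrite (cardsD1 i) iA (cardsD1 j) jAi; lia.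
move=> x /= /andP[/fD-> bij].
rewrite (slot_countD1 _ _ _ iA) (slot_countD1 _ _ _ jAi).
by move: bij; case: slot_bit; case: slot_bit.
Qed.

(** * Query algorithms for symmetric functions *)

Definition weight_on (B : {set 'I_n}) (x : input n) : nat := (\sum_(i in B) x i)%N.

Lemma weight_onD1 (B : {set 'I_n}) i x :
  i \in B -> weight_on B x = (x i + weight_on (B :\ i) x)%N.
Proof.
move=> iB; rewrite /weight_on (bigD1 i iB) /=; congr (_ + _)%N.
by apply: eq_bigl => k; rewrite !inE andbC.
Qed.

Lemma weight_on_le (B : {set 'I_n}) x : (weight_on B x <= #|B|)%N.
Proof. by rewrite -sum1_card; apply: leq_sum => i _; case: (x i). Qed.

(* [B], possibly negated, together with [p] constant zero bits. *)
Lemma padded_slots (B : {set 'I_n}) (c : bool) (p : nat) :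
  exists (K : finType) (lab : K -> option 'I_n) (neg : pred K) (A : {set K}),
    #|A| = (#|B| + p)%N /\
    forall x, slot_count lab neg A x =
      if c then (#|B| - weight_on B x)%N else weight_on B x.
Proof.
pose A := [set k : 'I_n + 'I_p | if k is inl i then i \in B else true].
exists ('I_n + 'I_p)%type, (fun k => if k is inl i then Some i else None).
exists (fun k => if k is inl _ then c else false), A; split.
  rewrite -sum1_card big_sumType /=; congr (_ + _)%N.
    by rewrite -sum1_card; apply: eq_bigl => i; rewrite inE.
  by rewrite -[RHS]card_ord -sum1_card; apply: eq_bigl => i; rewrite inE.
move=> x; rewrite /slot_count big_sumType /= [X in (_ + X)%N]big1 // addn0.
rewrite (eq_bigl (mem B)) => [|i]; last by rewrite inE.
case: c {A}; last by apply: eq_bigr => i _.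
rewrite -sum1_card /weight_on.
rewrite -sumnB; last by move=> i _; case: (x i).
by apply: eq_bigr => i _; rewrite /slot_bit /=; case: (x i).
Qed.

(** The trivial algorithm, reading the variables of [B] one by one. *)
Lemma solvable_on_symmetric (B : {set 'I_n}) (D : pred (input n)) (g : nat -> bool) :
  (forall x, D x -> f x = g (weight_on B x)) -> solvable_on #|B| D.
Proof.
move cardB: #|B| => m; elim: m B D g cardB => [|m IHm] B D g cardB fD.
  move/eqP: cardB; rewrite cards_eq0 => /eqP B0.
  apply: (@solvable_on_const _ _ (g 0%N)) => x /fD.
  by rewrite B0 /weight_on big_set0.
have [i iB] : exists i, i \in B by apply/card_gt0P; rewrite cardB.
apply: (@solvable_on_classical _ _ i) => b.
apply: (IHm (B :\ i) _ (fun k => g (b + k)%N)).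
  by move: cardB; rewrite (cardsD1 i) iB; lia.
by move=> x /= /andP[/fD-> /eqP xi]; rewrite (weight_onD1 _ iB) xi.
Qed.

(** Each element of [B] is compared with the pivot [i] by one XOR query: a difference settles the
    answer, an equality removes the element. *)
Lemma solvable_on_all_equal i (B : {set 'I_n}) (D : pred (input n)) e :
  i \notin B ->
  (forall x, D x -> f x = e (+) [forall j in B, x i == x j]) ->
  solvable_on #|B| D.
Proof.
move cardB: #|B| => m; elim: m B D cardB => [|m IHm] B D cardB iB fD.
  move/eqP: cardB; rewrite cards_eq0 => /eqP B0.
  apply: (@solvable_on_const _ _ (e (+) true)) => x /fD->; congr (_ (+) _).
  by apply/forall_inP => j; rewrite B0 inE.
have [j jB] : exists j, j \in B by apply/card_gt0P; rewrite cardB.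
apply: (@solvable_on_xor _ _ i j); first by apply: contraNneq iB => ->.
case; last first.
  apply: (@solvable_on_const _ _ e) => x /= /andP[/fD-> xij].
  rewrite -[RHS]addbF; congr (_ (+) _); apply/forall_inP => /(_ j jB) xij'.
  by rewrite xij' in xij.
apply: (IHm (B :\ j)); first by move: cardB; rewrite (cardsD1 j) jB; lia.
  by rewrite !inE (negbTE iB) andbF.
move=> x /= /andP[/fD-> /eqP xij]; congr (_ (+) _).
apply/forall_inP/forall_inP => [eqB k|eqB k kB].
  by rewrite inE => /andP[_ /eqB].
by case: (eqVneq k j) => [->//|kj]; apply: eqB; rewrite !inE kj.
Qed.

(** The profiles, by weight, of functions of [m] bits that isolate the all-zero input or the all-one
    input. For [m = 0] this holds vacuously. *)
Definition and_like (m : nat) (g : nat -> bool) : bool :=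
  all (fun k => g k == ~~ g 0%N) (iota 1 m) || all (fun k => g k == ~~ g m) (iota 0 m).

Lemma all_iotaP (P : pred nat) a m :
  reflect (forall k, (a <= k < a + m)%N -> P k) (all P (iota a m)).
Proof.
by apply: (iffP allP) => PP k; have := PP k; rewrite mem_iota.
Qed.

Lemma solvable_on_not_and_like (B : {set 'I_n}) (D : pred (input n)) (g : nat -> bool) :
  (forall x, D x -> f x = g (weight_on B x)) -> ~~ and_like #|B| g ->
  solvable_on #|B|.-1 D.
Proof.
move cardB: #|B| => m; elim: m B D g cardB => [|m IHm] B D g cardB fD //.
have [i iB] : exists i, i \in B by apply/card_gt0P; rewrite cardB.
have cardBi : #|B :\ i| = m by move: cardB; rewrite (cardsD1 i) iB; lia.
move=> nandg.
(* One weight [j] stands out: [m], or 1 after negating the variables ([c]). With [m.-1] padding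
   zeros there are [2 * m] slots, and the question is whether exactly half are ones. *)
have exact c j : (j = if c then 1 else m)%N ->
    (forall k, (k <= m.+1)%N -> g k = g j (+) (k != j)) -> (0 < m)%N ->
    solvable_on m D.
  move=> def_j gj m_gt0; have [K [lab [neg [A [cardA countA]]]]] := padded_slots B c m.-1.
  apply: (@solvable_on_exact_half _ lab neg _ A _ (~~ g j)); first by lia.
  move=> x Dx; rewrite fD // gj; last by rewrite -cardB weight_on_le.
  rewrite countA cardB; have := weight_on_le B x; rewrite cardB.
  move=> le_w; have -> : ((if c then (m.+1 - weight_on B x)%N else weight_on B x) == m)
      = (weight_on B x == j) by rewrite def_j; case: (c); lia.
  by case: (g j); case: eqP.
(* With [m.-2] padding zeros there are [2 * m.-1 + 1] slots, whose majority means at least [m] ones;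
   after negation ([c]) this is weight at most 1. *)
have threshold c : (forall k, (k <= m.+1)%N ->
      g k = g (if c then 0 else m)%N (+) (if c then 1 < k else k < m)%N) ->
    (1 < m)%N -> solvable_on m D.
  move=> gk m_gt1; have [K [lab [neg [A [cardA countA]]]]] := padded_slots B c m.-2.
  have -> : m = m.-1.+1 by lia.
  apply: (@solvable_on_majority _ lab neg _ A _ (~~ g (if c then 0 else m)%N)).
    by lia.
  move=> x Dx; rewrite fD // gk; last by rewrite -cardB weight_on_le.
  rewrite countA cardB; have := weight_on_le B x; rewrite cardB => le_w.
  case: (c); set w := weight_on B x in le_w *.
    have -> : (m.-1 < m.+1 - w)%N = ~~ (1 < w)%N by lia.
    by case: (g _); case: (ltnP 1).
  have -> : (m.-1 < w)%N = ~~ (w < m)%N by lia.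
  by case: (g _); case: (ltnP w).
(* Only the two extreme weights stand out, with a common value; [i] is the pivot. *)
have equal : (forall k, (0 < k <= m)%N -> g k = ~~ g 0%N) -> g m.+1 = g 0%N ->
    solvable_on m D.
  move=> gk gm; rewrite -cardBi.
  apply: (@solvable_on_all_equal i _ _ (~~ g 0%N)); first by rewrite !inE eqxx.
  move=> x Dx; rewrite fD // (weight_onD1 _ iB).
  have := weight_on_le (B :\ i) x; rewrite cardBi => le_w.
  have w0 : (weight_on (B :\ i) x == 0)%N = [forall j in B :\ i, ~~ x j].
    rewrite /weight_on sum_nat_eq0; apply: eq_forallb => j.
    by case: (j \in _); case: (x j).
  have wm : (weight_on (B :\ i) x == m)%N = [forall j in B :\ i, x j].
    rewrite -[m in LHS]cardBi -sum1_card /weight_on eq_sym.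
    rewrite (eq_bigr (fun j => x j + ~~ x j)%N); last by move=> j _; case: (x j).
    rewrite big_split /= -[X in _ == X]addn0 eqn_add2l sum_nat_eq0.
    by apply: eq_forallb => j; case: (j \in _); case: (x j).
  case xi: (x i).
    have -> : [forall j in B :\ i, true == x j] = [forall j in B :\ i, x j].
      by apply: eq_forallb => j; case: (j \in _); case: (x j).
    rewrite -wm; case: eqP => [->|ne]; rewrite add1n ?gm; first by case: (g _).
    by rewrite gk ?addbF //; lia.
  have -> : [forall j in B :\ i, false == x j] = [forall j in B :\ i, ~~ x j].
    by apply: eq_forallb => j; case: (j \in _); case: (x j).
  rewrite -w0 add0n; case: eqP => [->|ne]; first by case: (g _).
  by rewrite gk ?addbF //; lia.
(* On one variable, failing [and_like] means that [g] is constant. *)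
case: (posnP m) => [m0|m_gt0].
  apply: equal => [k|]; first by lia.
  move: nandg; rewrite m0 /and_like /= andbT.
  by case: (g 1%N); case: (g 0%N).
(* The restriction to [x i = 0] has profile [g] on weights up to [m]; if it is [and_like], only the
   value [g m.+1] remains to be examined. *)
case: (boolP (and_like m g)) => [|nand0].
  case/orP => /all_iotaP gk.
    apply: equal => [k km|]; first by apply/eqP/gk; lia.
    apply/eqP; apply: contraNT nandg => gm; apply/orP; left; apply/all_iotaP => k km.
    case: (ltnP k m.+1) => [km'|mk]; first by apply: gk; lia.
    have -> : k = m.+1 by lia.
    by move: gm; case: (g m.+1); case: (g 0%N).
  have {}gk k : (k < m)%N -> g k = ~~ g m by move=> km; apply/eqP/gk; lia.
  case: (eqVneq (g m.+1) (g m)) => gm.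
    case: (ltnP 1 m) => m1.
      apply: (threshold false) => // k km; case: (ltnP k m) => [/gk->|mk].
        by rewrite addbT.
      by rewrite addbF; have /orP[/eqP->|/eqP->//] : (k == m.+1) || (k == m) by lia.
    (* On two variables this profile isolates weight 0, against [nandg]. *)
    have m1' : m = 1%N by lia.
    move: nandg gm (gk 0%N); rewrite m1' /and_like /= => nandg gm /(_ isT) g0.
    by move: nandg; rewrite gm g0; case: (g 1%N).
  apply: (exact false m) => // k km; case: (ltnP k m) => [km'|mk].
    by rewrite gk // ltn_eqF // addbT.
  have /orP[/eqP->|/eqP->] : (k == m.+1) || (k == m) by lia.
    by rewrite gtn_eqF // addbT; move: gm; case: (g _); case: (g _).
  by rewrite eqxx addbF.
(* The mirror case [x i = 1], where only the value [g 0] remains to be examined. *)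
case: (boolP (and_like m (g \o succn))) => [|nand1].
  case/orP => /all_iotaP /= gk.
    have {}gk k : (1 < k <= m.+1)%N -> g k = ~~ g 1%N.
      by case: k => // k km; apply/eqP/gk; lia.
    case: (eqVneq (g 0%N) (g 1%N)) => g01.
      case: (ltnP 1 m) => m1.
        apply: (threshold true) => // k km; case: (ltnP 1 k) => [k1|].
          by rewrite gk ?k1 // addbT g01.
        by case: k km => [|[|//]] _ _; rewrite addbF.
      have m1' : m = 1%N by lia.
      move: nandg (gk 2%N); rewrite m1' /and_like /= => nandg /(_ isT) g2.
      by move: nandg; rewrite g01 g2; case: (g 1%N).
    apply: (exact true 1%N) => // k km; case: k km => [|[|k]] km.
    - by rewrite addbT; move: g01; case: (g _); case: (g _).
    - by rewrite eqxx addbF.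
    - by rewrite gk // addbT.
  have {}gk k : (0 < k <= m)%N -> g k = ~~ g m.+1.
    by case: k => // k km; apply/eqP/gk; lia.
  case: (eqVneq (g m.+1) (g 0%N)) => gm.
    by apply: equal => // k km; rewrite gk // gm.
  case/negP: nandg; apply/orP; right; apply/all_iotaP => k km; apply/eqP.
  case: k km => [|k] km; last by apply: gk; lia.
  by move: gm; case: (g _); case: (g _).
have -> : m.+1.-1 = m.-1.+1 by lia.
apply: (@solvable_on_classical _ _ i) => b.
apply: (IHm (B :\ i) _ (fun k => g (b + k)%N)) => //.
  by move=> x /= /andP[/fD-> /eqP xi]; rewrite (weight_onD1 _ iB) xi.
by case: b.
Qed.

End Gram.

(** * Orthogonal maps between families with equal Gram matrices *)

Section Orthogonal.
Variables (R : realType) (M : nat).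
Implicit Types (u v w : 'cV[R]_M).

Definition dot u v : R := (u^T *m v) 0 0.

Lemma dotE u v : dot u v = \sum_k u k 0 * v k 0.
Proof. by rewrite /dot mxE; apply: eq_bigr => k _; rewrite mxE. Qed.

Lemma dotC u v : dot u v = dot v u.
Proof. by rewrite !dotE; apply: eq_bigr => k _; rewrite mulrC. Qed.

Lemma dotBl u v w : dot (u - v) w = dot u w - dot v w.
Proof. by rewrite /dot linearB /= mulmxBl !mxE. Qed.

Lemma dotBr u v w : dot w (u - v) = dot w u - dot w v.
Proof. by rewrite dotC dotBl !(dotC w). Qed.

Lemma dot_eq0 u : dot u u = 0 -> u = 0.
Proof.
move=> uu0; apply/matrixP => k j; rewrite ord1 [RHS]mxE; apply/eqP.
have sqr_u : \sum_i u i 0 ^+ 2 = 0 by rewrite -[RHS]uu0 dotE; apply: eq_bigr.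
by rewrite -sqrf_eq0 (psumr_eq0P (fun i _ => sqr_ge0 (u i 0)) sqr_u).
Qed.

(* For [w = 0] this is the identity, as [2 / 0 = 0]. *)
Definition reflection w : 'M[R]_M := 1%:M - (2 / dot w w) *: (w *m w^T).

Lemma reflectionE w v : reflection w *m v = v - (2 / dot w w * dot w v) *: w.
Proof.
rewrite /reflection mulmxBl mul1mx -scalemxAl -mulmxA.
by rewrite [w^T *m v]mx11_scalar mul_mx_scalar scalerA.
Qed.

Lemma reflectionK w : reflection w *m reflection w = 1%:M.
Proof.
have -> : reflection w *m reflection w =
    1%:M - (2 / dot w w * (2 - 2 / dot w w * dot w w)) *: (w *m w^T).
  rewrite {2}/reflection mulmxBr mulmx1 -scalemxAr mulmxA reflectionE.
  rewrite mulmxBl -scalemxAl /reflection scalerBr scalerA -addrA -opprD.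
  by rewrite addrA -scalerDl -scalerBl; congr (_ - _ *: _); ring.
case: (eqVneq (dot w w) 0) => [->|ww]; first by rewrite invr0 mulr0 mul0r scale0r subr0.
by rewrite divfK // subrr mulr0 scale0r subr0.
Qed.

Lemma trmx_reflection w : (reflection w)^T = reflection w.
Proof. by rewrite /reflection linearB /= linearZ /= trmx1 trmx_mul trmxK. Qed.

Lemma reflection_swap u v : dot u u = dot v v -> reflection (u - v) *m u = v.
Proof.
move=> uv; rewrite reflectionE; have [w0|w0] := eqVneq (dot (u - v) (u - v)) 0.
  by move/subr0_eq: (dot_eq0 w0) => ->; rewrite subrr scaler0 subr0.
have ww : dot (u - v) (u - v) = 2 * dot (u - v) u.
  by rewrite !dotBl !dotBr (dotC v u) -uv; ring.
have -> : 2 / dot (u - v) (u - v) * dot (u - v) u = 1 by rewrite mulrAC -ww divff.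
by rewrite scale1r opprB addrC subrK.
Qed.

Lemma reflection_fix w v : dot w v = 0 -> reflection w *m v = v.
Proof. by move=> wv; rewrite reflectionE wv mulr0 scale0r subr0. Qed.

(** The map [U] for the tail is followed by the reflection taking [U *m a x] to [b x]. It fixes
    every earlier [b y], because equality of inner products makes [b y] orthogonal to the difference
    of these two vectors. *)
Lemma exists_orthogonal_map (T : eqType) (r : seq T) (a b : T -> 'cV[R]_M) :
  {in r &, forall x y, dot (a x) (a y) = dot (b x) (b y)} ->
  exists2 U : 'M[R]_M, U *m U^T = 1%:M & {in r, forall x, U *m a x = b x}.
Proof.
elim: r => [|x r IHr] ab; first by exists 1%:M; rewrite ?trmx1 ?mulmx1.
have [|U UU Ur] := IHr.
  by move=> y z yr zr; apply: ab; rewrite inE ?yr ?zr orbT.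
have UU' : U^T *m U = 1%:M by exact: mulmx1C.
have dotU u v : dot (U *m u) (U *m v) = dot u v.
  by rewrite /dot trmx_mul mulmxA -(mulmxA u^T) UU' mulmx1.
exists (reflection (U *m a x - b x) *m U).
  by rewrite trmx_mul trmx_reflection mulmxA -(mulmxA (reflection _)) UU mulmx1 reflectionK.
move=> y; rewrite inE -mulmxA => /predU1P[->|yr].
  by apply: reflection_swap; rewrite dotU ab ?mem_head.
rewrite (Ur y yr) reflection_fix // dotBl -[in X in X - _](Ur y yr) dotU ab ?subrr //.
  by rewrite mem_head.
by rewrite inE yr orbT.
Qed.

End Orthogonal.

(** * From Gram matrices to quantum algorithms *)

Section Compile.
Variables (R : realType) (n : nat) (f : boolfun n).

Lemma solvable_run t (G : input n -> input n -> R) : solvable f t G ->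
  exists s : nat -> amplitudes R n,
    [/\ forall x y, gram (s 0) x y = G x y,
        forall j x y, (j < t)%N -> query_gram (s j) x y = gram (s j.+1) x y &
        forall x y, f x != f y -> gram (s t) x y = 0].
Proof.
elim: t G => [|t IHt] G /= [s Gs solG].
  by exists (fun=> s); split=> // x y fxy; rewrite -Gs solG.
have [r [r0 rS rt]] := IHt _ solG.
exists (fun j => if j is j'.+1 then r j' else s); split=> // [[|j] x y jt].
  by rewrite r0.
by rewrite rS.
Qed.

(** A basis state is a triple of output bit, query label and list position, with [M] bounding all
    list lengths so that one space serves throughout. *)
Lemma solvable_algorithm t : solvable f t (fun _ _ => 1 : R) ->
  exists A : qalgorithm R n t, computes_exactly A f.
Proof.
case/solvable_run => s [s0 sS st].
pose M := (\max_(j < t.+1) size (s j))%N.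
have sizeM j : (j <= t)%N -> (size (s j) <= M)%N.
  by rewrite -ltnS => jt; have := @leq_bigmax _ (fun j : 'I_t.+1 => size (s j)) (Ordinal jt).
pose K : finType := (bool * (option 'I_n * 'I_M))%type.
pose lab (k : 'I_#|K|) := (enum_val k).2.1.
pose out (k : 'I_#|K|) := (enum_val k).1.
pose pos (k : 'I_#|K|) : nat := (enum_val k).2.2.
(* The default has amplitude zero, so positions past the end of a list contribute nothing. *)
pose d : option 'I_n * (input n -> R) := (None, fun=> 0).
(* The output bit is set to [f x] only at the end. This makes states with different answers
   orthogonal, as the final Gram matrix prescribes. *)
pose flag j x := (j == t) && f x.
pose vec j x : 'cV[R]_#|K| := \col_k
  if (out k == flag j x) && (lab k == (nth d (s j) (pos k)).1)
  then (nth d (s j) (pos k)).2 x else 0.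
pose sgn x : 'M[R]_#|K| := diag_mx (\row_k bit_sign R (lab k) x).
(* A general [F] covers both inner products: 1 gives [gram], a product of two signs gives
   [query_gram]. *)
have sum_vec (F : option 'I_n -> R) j x y : (j <= t)%N ->
    \sum_k F (lab k) * (vec j x k 0 * vec j y k 0) =
    if flag j x == flag j y then
      \sum_(p <- s j) F p.1 * (p.2 x * p.2 y) else 0.
  move=> jt.
  pose body x0 m := (nth d (s j) m).2 x0.
  rewrite (reindex_onto (fun k : K => enum_rank k) enum_val) /=; last first.
    by move=> k _; rewrite enum_valK.
  rewrite (eq_bigl predT); last by move=> k; rewrite enum_rankK eqxx.
  rewrite (eq_bigr (fun k : K => if (k.1 == flag j x) && (k.1 == flag j y) &&
      (k.2.1 == (nth d (s j) k.2.2).1) then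
      F (nth d (s j) k.2.2).1 * (body x k.2.2 * body y k.2.2) else 0)); last first.
    move=> k _; rewrite !mxE /out /lab /pos enum_rankK; case: k => c [l m] /=.
    case: (eqVneq l _) => [->|_]; last by rewrite !andbF !mulr0.
    by rewrite !andbT; case: (c == _); case: (c == _); rewrite ?mulr0 ?mul0r ?mulr0.
  rewrite -(pair_big xpredT xpredT (fun c (q : option 'I_n * 'I_M) =>
      if (c == flag j x) && (c == flag j y) && (q.1 == (nth d (s j) q.2).1) then
      F (nth d (s j) q.2).1 * (body x q.2 * body y q.2) else 0)) /=.
  have sumq c : \sum_(q : option 'I_n * 'I_M)
     (if c && (q.1 == (nth d (s j) q.2).1) then
      F (nth d (s j) q.2).1 * (body x q.2 * body y q.2) else 0) =
     if c then \sum_(p <- s j) F p.1 * (p.2 x * p.2 y) else 0.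
    case: c => /=; last by rewrite big1.
    rewrite -(pair_big xpredT xpredT (fun l (m : 'I_M) =>
      if l == (nth d (s j) m).1 then F (nth d (s j) m).1 * (body x m * body y m) else 0)) /=.
    rewrite exchange_big /= (big_nth d) big_mkord.
    rewrite (eq_bigr (fun m : 'I_M => F (nth d (s j) m).1 * (body x m * body y m))); last first.
      by move=> m _; rewrite -big_mkcond /= big_pred1_eq.
    rewrite (big_ord_widen M (fun m => F (nth d (s j) m).1 * (body x m * body y m)) (sizeM j jt)).
    rewrite [RHS]big_mkcond; apply: eq_bigr => m _; case: ltnP => // sm.
    by rewrite /body nth_default //= mul0r mulr0.
  rewrite (eq_bigr _ (fun c _ => sumq _)) big_bool /=.
  by case: (flag j x); case: (flag j y); rewrite /= ?addr0 ?add0r.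
have dot_vec j x y : (j <= t)%N -> dot (vec j x) (vec j y) = gram (s j) x y.
  move=> jt; rewrite dotE; transitivity (\sum_k 1 * (vec j x k 0 * vec j y k 0)).
    by apply: eq_bigr => k _; rewrite mul1r.
  rewrite (sum_vec (fun=> 1)) // /gram.
  rewrite (eq_bigr (fun p => p.2 x * p.2 y)) => [|p _]; last by rewrite mul1r.
  case: eqP => // /eqP; rewrite /flag; case: (eqVneq j t) => [->|] //= fxy.
  by rewrite -[RHS]/(gram (s t) x y) st.
have dot_query j x y : (j < t)%N ->
    dot (sgn x *m vec j x) (sgn y *m vec j y) = query_gram (s j) x y.
  move=> jt; rewrite dotE.
  transitivity (\sum_k bit_sign R (lab k) x * bit_sign R (lab k) y *
      (vec j x k 0 * vec j y k 0)).
    by apply: eq_bigr => k _; rewrite !mul_diag_mx !mxE; ring.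
  rewrite (sum_vec (fun l => bit_sign R l x * bit_sign R l y)) ?(ltnW jt) //.
  by rewrite /flag ltn_eqF.
have norm_vec j x : (j <= t)%N -> gram (s j) x x = 1.
  elim: j => [|j IHj] jt; first exact: s0.
  rewrite -sS // -[RHS]IHj; last exact: ltnW.
  by apply: eq_bigr => p _; rewrite bit_signM mul1r.
(* The initial state cannot depend on the input; any fixed [z] serves, as the first Gram matrix is
   all ones. *)
pose z : input n := [ffun=> false].
pose before j x := if j is j'.+1 then sgn x *m vec j' x else vec 0%N z.
have [U UP] : exists U : nat -> 'M[R]_#|K|, forall j, (j <= t)%N ->
    U j *m (U j)^T = 1%:M /\ forall x, U j *m before j x = vec j x.
  suff /choice[U UP] : forall j, exists U : 'M[R]_#|K|, (j <= t)%N ->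
      U *m U^T = 1%:M /\ forall x, U *m before j x = vec j x by exists U.
  move=> j; case: (leqP j t) => [jt|]; last by exists 1%:M.
  have [|U UU Ub] := @exists_orthogonal_map R _ _ (enum (input n)) (before j) (vec j).
    move=> x y _ _; case: j jt => [|j] jt /=; last by rewrite dot_query // sS // dot_vec.
    by rewrite !dot_vec // !s0.
  by exists U => _; split=> // x; rewrite Ub ?mem_enum.
pose toC := real_complex R.
have normC (x : R) : `|toC x| ^+ 2 = toC (x ^+ 2).
  by rewrite sqr_normc conjc_real -rmorphM.
have init_norm : \sum_k `|(map_mx toC (vec 0%N z)) k 0| ^+ 2 = 1.
  rewrite (eq_bigr (fun k => toC (vec 0%N z k 0 * vec 0%N z k 0))).
    by rewrite -rmorph_sum -dotE dot_vec // norm_vec // rmorph1.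
  by move=> k _; rewrite mxE normC.
have unitary j : (j <= t)%N -> map_mx toC (U j) \is unitarymx.
  move=> /UP[UU _]; apply/unitarymxP.
  have -> : ((map_mx toC (U j)) ^t*)%sesqui = map_mx toC (U j)^T.
    by apply/matrixP => k l; rewrite !mxE; exact: conjc_real.
  by rewrite -map_mxM UU map_mx1.
pose A := QAlgorithm lab out init_norm unitary; exists A => x.
have stateE j : (j <= t)%N -> qstate A x j = map_mx toC (vec j x).
  elim: j => [|j IHj] jt /=; first by rewrite -map_mxM -(proj2 (UP 0%N jt) x).
  rewrite (IHj (ltnW jt)) -(proj2 (UP j.+1 jt) x) /before !map_mxM; congr (_ *m (_ *m _)).
  rewrite /query_mx map_diag_mx; congr diag_mx; apply/rowP => k; rewrite !mxE /=.
  by rewrite /bit_sign; case: (lab k) => [i|]; rewrite ?rmorph1 // rmorph_sign.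
rewrite /output_prob stateE // big_mkcond /=.
rewrite (eq_bigr (fun k => toC (vec t x k 0 * vec t x k 0))).
  by rewrite -rmorph_sum -dotE dot_vec // norm_vec // rmorph1.
move=> k _; rewrite [X in `|X|]mxE normC -expr2; case: eqP => // /eqP out_k.
by rewrite mxE /flag eqxx /= (negbTE out_k) /= expr0n rmorph0.
Qed.

End Compile.

(** * Fourier characters of the cube *)

Section Characters.
Variables (C : numDomainType) (n : nat).

Definition character (S : {set 'I_n}) (x : input n) : C :=
  (-1) ^+ weight_on S x.

Lemma sum_character_eq0 (S : {set 'I_n}) i :
  i \in S -> \sum_x character S x = 0.
Proof.
move=> iS; pose flip (x : input n) : input n := [ffun j => (j == i) (+) x j].
have flipK : involutive flip.
  by move=> x; apply/ffunP => j; rewrite !ffunE addbA addbb.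
have chi_flip x : character S (flip x) = - character S x.
  rewrite /character !(weight_onD1 _ iS) !exprD ffunE eqxx addTb.
  have -> : weight_on (S :\ i) (flip x) = weight_on (S :\ i) x.
    by apply: eq_bigr => j; rewrite !inE ffunE => /andP[/negbTE->].
  by rewrite signrN mulNr.
have : \sum_x character S x = - \sum_x character S x.
  rewrite [LHS](reindex_inj (inv_inj flipK)) -sumrN.
  by apply: eq_bigr => x _; rewrite chi_flip.
by move/eqP; rewrite -addr_eq0 -mulr2n mulrn_eq0 => /eqP.
Qed.

(** [S'] is the symmetric difference of [S] and the singleton of [i], so a query changes degrees by
    at most one. *)
Lemma character_mul_sign (S : {set 'I_n}) i : exists S' : {set 'I_n},
  (#|S| <= #|S'|.+1)%N /\
  forall x, character S x * (-1) ^+ x i = character S' x.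
Proof.
case: (boolP (i \in S)) => iS.
  exists (S :\ i); split=> [|x]; first by rewrite (cardsD1 i) iS.
  by rewrite /character (weight_onD1 _ iS) exprD mulrAC -expr2 sqrr_sign mul1r.
exists (i |: S); split=> [|x]; first by rewrite cardsU1 iS; lia.
by rewrite /character /weight_on big_setU1 // exprD mulrC.
Qed.

End Characters.

(** * The polynomial method *)

Section LowerBound.
Variables (R : realType) (n t : nat) (A : qalgorithm R n t).

(* The amplitudes after [j] queries are polynomials of degree at most [j]. *)
Lemma sum_character_qstate (S : {set 'I_n}) j : (j < #|S|)%N ->
  \sum_x character R[i] S x *: qstate A x j = 0.
Proof.
(* The degree bound is expressed as the vanishing of the Fourier coefficients at all sets with more
   than [j] elements. *)
elim: j S => [|j IHj] S jS /=.
  have [i iS] : exists i, i \in S by apply/card_gt0P.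
  by rewrite -scaler_suml (sum_character_eq0 _ iS) scale0r.
rewrite (eq_bigr (fun x =>
  qunitary A j.+1 *m (character R[i] S x *: (query_mx A x *m qstate A x j)))); last first.
  by move=> x _; rewrite scalemxAr.
rewrite -mulmx_sumr; suff -> : \sum_x character R[i] S x *: (query_mx A x *m qstate A x j) = 0.
  by rewrite mulmx0.
apply/colP => k; rewrite summxE [RHS]mxE.
have [S' jS' chiS'] : exists2 S' : {set 'I_n}, (j < #|S'|)%N & forall x,
    character R[i] S x * (if qlabel k is Some i then (-1) ^+ x i else 1) = character R[i] S' x.
  case: (qlabel k) => [i|]; last by exists S => [|x]; rewrite ?mulr1 // ltnW.
  have [S' [SS' chiS']] := character_mul_sign R[i] S i.
  by exists S' => //; lia.
have /colP/(_ k) := IHj S' jS'; rewrite summxE [X in _ = X]mxE => sumS'.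
by rewrite -[RHS]sumS'; apply: eq_bigr => x _; rewrite [LHS]mxE [RHS]mxE mul_diag_mx !mxE mulrA chiS'.
Qed.

Lemma sum_sqr_norm_unitary m (U : 'M[R[i]]_m) (v : 'cV[R[i]]_m) :
  U \is unitarymx -> \sum_k `|(U *m v) k 0| ^+ 2 = \sum_k `|v k 0| ^+ 2.
Proof.
move=> /unitarymxP/mulmx1C UU.
have normE (w : 'cV[R[i]]_m) : \sum_k `|w k 0| ^+ 2 = ((w ^t*)%sesqui *m w) 0 0.
  by rewrite mxE; apply: eq_bigr => k _; rewrite !mxE normCK mulrC.
rewrite !normE trmx_mul map_mxM mulmxA; congr (fun_of_matrix _ 0 0).
by rewrite -(mulmxA (v ^t*)%sesqui) UU mulmx1.
Qed.

Lemma qstate_norm x j : (j <= t)%N -> \sum_k `|qstate A x j k 0| ^+ 2 = 1.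
Proof.
have [norm_init unitary] : \sum_k `|qinit A k 0| ^+ 2 = 1 /\
    forall j, (j <= t)%N -> qunitary A j \is unitarymx by case: A.
elim: j => [|j IHj] jt; rewrite sum_sqr_norm_unitary ?unitary //.
rewrite -(IHj (ltnW jt)); apply: eq_bigr => k _.
rewrite mul_diag_mx !mxE normrM.
by case: (qlabel k) => [i|]; rewrite ?normrX ?normrN1 ?normr1 ?expr1n mul1r.
Qed.

(** Exactness makes every amplitude with output [f x0] vanish away from [x0], so its top Fourier
    coefficient is, up to sign and scaling, its value at [x0]. With fewer than [n] queries that
    coefficient is zero, and [x0] could not be answered. *)
Lemma isolated_point_queries (f : boolfun n) x0 :
  computes_exactly A f -> (forall x, f x = f x0 -> x = x0) -> (n <= t)%N.
Proof.
move=> compA iso; rewrite leqNgt; apply/negP => tn.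
have amp0 x k : x != x0 -> qoutput k = f x0 -> qstate A x t k 0 = 0.
  move=> xx0 out_k; have fx : f x != f x0 by apply: contraNneq xx0 => /iso->.
  have := qstate_norm x (leqnn t); rewrite (bigID (fun k => qoutput k == f x)) /=.
  rewrite [X in X + _](compA x) -[X in _ = X]addr0 => /addrI/psumr_eq0P amp.
  apply/eqP; rewrite -normr_eq0 -sqrf_eq0 amp // => [i _|].
    exact: exprn_ge0.
  by rewrite out_k eq_sym.
have : output_prob A x0 (f x0) = 0.
  apply: big1 => k /eqP out_k.
  have : (t < #|[set: 'I_n]|)%N by rewrite cardsT card_ord.
  move/sum_character_qstate/colP/(_ k); rewrite summxE [X in _ = X]mxE.
  rewrite (bigD1 x0) //= big1 => [|x xx0]; last by rewrite mxE amp0 ?mulr0.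
  rewrite addr0 mxE => /eqP; rewrite mulf_eq0 signr_eq0 /= => /eqP->.
  by rewrite normr0 expr0n.
by rewrite compA => /eqP; rewrite oner_eq0.
Qed.

End LowerBound.

(** * Symmetric functions and isomorphism with AND *)

Section SymmetricFunctions.
Variables (n : nat) (f : boolfun n).

Definition profile (k : nat) : bool := f [ffun i : 'I_n => i < k]%N.

Lemma weight_onT (x : input n) : weight_on setT x = weight x.
Proof.
rewrite /weight_on /weight -sum1_card big_mkcond [RHS]big_mkcond /=.
by apply: eq_bigr => i _; rewrite !inE; case: (x i).
Qed.

Lemma symmetric_profile : symmetric_fun f ->
  forall x, f x = profile (weight_on setT x).
Proof.
move=> symf x; apply: symf; rewrite -!weight_onT.
have := weight_on_le setT x; rewrite cardsT card_ord.
move: (weight_on _ x) => w wn; rewrite /weight_on.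
rewrite (eq_bigr (fun i : 'I_n => (i < w)%N : nat)) => [|i _]; last by rewrite ffunE.
rewrite (eq_bigl predT) => [|i]; last by rewrite inE.
have {1}-> : w = (\sum_(i < w) 1)%N by rewrite sum1_card card_ord.
rewrite (big_ord_widen n (fun=> 1%N) wn) big_mkcond.
by apply: eq_bigr => i _; case: (i < w)%N.
Qed.

(** All variables are negated if the isolated weight is 0, none if it is [n]; the output is negated
    when the isolated value is false. *)
Lemma and_like_isomorphic : symmetric_fun f ->
  and_like n profile -> isomorphic f (@AND n).
Proof.
move=> symf /orP[]/all_iotaP gP.
  exists 1%g, [ffun=> true], (~~ profile 0) => x; rewrite (symmetric_profile symf).
  have -> : AND [ffun i => [ffun=> true] i (+) x ((1%g : 'S_n) i)] = (weight_on setT x == 0%N).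
    rewrite /weight_on sum_nat_eq0; apply: eq_forallb => i.
    by rewrite !ffunE perm1 inE; case: (x i).
  case: posnP => [->|w0]; first by case: (profile 0).
  rewrite addbF; apply/eqP/gP; rewrite w0 /=.
  by have := weight_on_le setT x; rewrite cardsT card_ord; lia.
exists 1%g, [ffun=> false], (~~ profile n) => x; rewrite (symmetric_profile symf).
have := weight_on_le setT x; rewrite cardsT card_ord => wn.
have -> : AND [ffun i => [ffun=> false] i (+) x ((1%g : 'S_n) i)] = (weight_on setT x == n).
  have -> : (weight_on setT x == n) = (weight_on setT [ffun i => ~~ x i] == 0%N).
    have : (weight_on setT x + weight_on setT [ffun i => ~~ x i])%N = n.
      rewrite /weight_on -big_split /= -[RHS]card_ord -cardsT -sum1_card.
      by apply: eq_bigr => i _; rewrite ffunE; case: (x i).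
    by lia.
  rewrite /weight_on sum_nat_eq0; apply: eq_forallb => i.
  by rewrite !ffunE perm1 inE; case: (x i).
case: eqP => [->|/eqP w]; first by case: (profile n).
by rewrite addbF; apply/eqP/gP; lia.
Qed.

(** The isolated point is the preimage of the all-ones input. *)
Lemma isomorphic_AND_isolated : isomorphic f (@AND n) ->
  exists x0, forall x, f x = f x0 -> x = x0.
Proof.
case=> s [b [c fE]]; exists [ffun j => ~~ b ((s^-1)%g j)] => x.
rewrite !fE => /addbI; have -> : AND [ffun i => b i (+)
    [ffun j => ~~ b ((s^-1)%g j)] (s i)] = true.
  by apply/forallP => i; rewrite !ffunE permK addbN addbb.
move=> /forallP all1; apply/ffunP => j; have := all1 ((s^-1)%g j).
by rewrite !ffunE permKV; case: (b _); case: (x j).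
Qed.

End SymmetricFunctions.

Theorem theorem1 (R : realType) (n : nat) (f : boolfun n)
    (hf : symmetric_fun f) :
  exact_query_complexity_is R f n <-> isomorphic f (@AND n).
Proof.
have profileE (x : input n) : xpredT x -> f x = profile f (weight_on setT x).
  by move=> _; exact: symmetric_profile.
have algo t : solvable_on R f t xpredT ->
    exists A : qalgorithm R n t, computes_exactly A f.
  by move=> sol; apply: solvable_algorithm; apply: eq_solvable sol => x y; rewrite mulr1.
split=> [[_ lower]|isof]; last split.
- apply: and_like_isomorphic => //; apply: contraT => nand.
  have := solvable_on_not_and_like R profileE; rewrite cardsT card_ord.
  (* For [n = 0] the profile would be [and_like] vacuously. Positivity makes [n.-1] queries a strict
     saving, against minimality. *)
  have n_gt0 : (0 < n)%N.
    rewrite lt0n; apply: contraNneq nand => n0.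
    by apply/orP; left; apply/all_iotaP => k; lia.
  by case/(_ nand)/algo => B /lower; lia.
- by apply: algo; have := solvable_on_symmetric R profileE; rewrite cardsT card_ord.
- by move=> t A compA; have [x0] := isomorphic_AND_isolated isof; exact: isolated_point_queries.
Qed.
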